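(* Let $p\geq 5$ be a prime. Then $$r_p(\mathbb{F}_p^3) \geq (p-1)^3+p-2\sqrt{p}=p^3-3p^2+4p-2\sqrt{p}-1.$$
   Context: For a prime $p$, an integer $k\geq 3$ with $k\le p$ and $n\in\mathbb{N}$, a $k$-progression in $\mathbb{F}_p^n$ is a set of $k$ points of the form $\{a+ib : i\in\{0,1,\dots,k-1\}\}$ with $a,b\in\mathbb{F}_p^n$, $b\neq 0$ (i.e. $k$ points in arithmetic progression). $r_k(\mathbb{F}_p^n)$ denotes the maximum cardinality of a subset of $\mathbb{F}_p^n$ containing no $k$-progression. For $k=p$, $p$-progressions are exactly the affine lines of $\mathbb{F}_p^n$, so $r_p(\mathbb{F}_p^n)$ is the maximum size of a subset of $\mathbb{F}_p^n$ containing no full affine line. *)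

(* Defs.v *)
From HB Require Import structures.
From mathcomp Require Import all_boot all_order all_algebra.

Set Implicit Arguments.
Unset Strict Implicit.
Unset Printing Implicit Defensive.

Import Order.TTheory GRing.Theory Num.Theory.
Local Open Scope ring_scope.

(* ['F_p] is the field with p elements only for p prime, and the points below
   are k distinct points only for k <= p and b != 0; the definitions are meant
   to be used under these assumptions. *)

Definition progression (p n k : nat) (a b : 'rV['F_p]_n) : {set 'rV['F_p]_n} :=
  [set a + b *+ i | i : 'I_k].

Definition is_progression (p n k : nat) (P : {set 'rV['F_p]_n}) : bool :=
  [exists a : 'rV['F_p]_n, exists b : 'rV['F_p]_n,
    (b != 0) && (P == progression k a b)].

Definition progression_free (p n k : nat) (A : {set 'rV['F_p]_n}) : bool :=
  [forall P : {set 'rV['F_p]_n}, is_progression k P ==> ~~ (P \subset A)].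

(* r_k(F_p^n); the empty set is progression-free for k >= 1, so the default
   value 0 of \max plays no role. *)
Definition r_ (k p n : nat) : nat :=
  \max_(A : {set 'rV['F_p]_n} | progression_free k A) #|A|.

(* Main.v *)
Require Import Defs.
From HB Require Import structures.
From mathcomp Require Import all_boot all_order all_algebra.
From mathcomp Require Import ring lra zify.
Import Order.TTheory GRing.Theory Num.Theory.
Local Open Scope ring_scope.

(** The complement of a line-free set is a set [B] meeting every line, so we
    build [B] with at most 3p^2 - 4p + 1 + 2 sqrt p points.  Let [D] be a set
    of residues containing 0 whose differences cover F_p; write every d as
    w(d) - (w(d) - d) with both terms in [D].  Take
    - all points of the plane z = 0 except the (c, 0, 0) with c not in [D];
    - for z <> 0 the line y = x z, whose union over z is a quadric;
    - for z <> 0 and d <> 0 one point of the parallel y - x z = d z, namely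
      (1/z - d, 1, z), or (-d, 0, z) if w(d) = 1/z.
    The last two items meet every line contained in a plane z = const <> 0.
    A line (c + s z, t z, z) through a hole (c, 0, 0) meets the quadric off
    z = 0 unless exactly one of s = 0 and t = c holds; these exceptional lines
    are met by the last family because w(d) and w(d) - d are never equal to
    c. *)

(** * The set meeting every line of F^3 *)

Section BlockingSet.
Variable F : finFieldType.

Definition point3 (x y z : F) : 'rV[F]_3 := \row_i nth 0 [:: x; y; z] i.

Lemma point3E (v : 'rV[F]_3) :
  v = point3 (v ord0 (inord 0)) (v ord0 (inord 1)) (v ord0 (inord 2)).
Proof.
by apply/rowP=> -[[|[|[|i]]] Hi] //; rewrite mxE /=; congr (v _ _);
   apply/val_inj; rewrite /= inordK.
Qed.

Lemma point3_line x y z u v w t :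
  point3 x y z + t *: point3 u v w
  = point3 (x + t * u) (y + t * v) (z + t * w).
Proof. by apply/rowP=> -[[|[|[|i]]] Hi] //; rewrite !mxE. Qed.

Lemma point3_eq0 : point3 0 0 0 = 0.
Proof. by apply/rowP=> -[[|[|[|i]]] Hi] //; rewrite !mxE. Qed.

Lemma eq_point3 (A : {set 'rV[F]_3}) x y x' y' z :
  x = x' -> y = y' -> point3 x y z \in A -> point3 x' y' z \in A.
Proof. by move=> -> ->. Qed.

Variables (D : {set F}) (w : F -> F).

Definition holed_plane : {set 'rV[F]_3} :=
  [set point3 q.1 q.2 0 | q in setX setT [set~ 0] :|: setX D [set 0]].

Definition quadric : {set 'rV[F]_3} :=
  [set point3 q.1 (q.1 * q.2) q.2 | q in setX setT [set~ 0]].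

Definition parallel_point (d z : F) : 'rV[F]_3 :=
  if w d == z^-1 then point3 (- d) 0 z else point3 (z^-1 - d) 1 z.

Definition parallel_points : {set 'rV[F]_3} :=
  [set parallel_point q.1 q.2 | q in setX [set~ 0] [set~ 0]].

Definition blocking_set := holed_plane :|: quadric :|: parallel_points.

(** With q = [#|F|], the three pieces have at most q(q-1) + [#|D|], q(q-1) and (q-1)^2 points. The
    term in 4q stands on the left to avoid truncated subtraction. *)
Lemma card_blocking_set :
  (#|blocking_set| + 4 * #|F| <= 3 * #|F| ^ 2 + 1 + #|D|)%N.
Proof.
have F1 : (0 < #|F|)%N by apply/card_gt0P; exists 0.
have cN : #|[set~ (0 : F)]| = #|F|.-1 by rewrite cardsC1.
have h1 : (#|holed_plane| <= #|F| * #|F|.-1 + #|D|)%N.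
  apply: leq_trans (leq_imset_card _ _) _.
  by apply: leq_trans (leq_card_setU _ _) _; rewrite !cardsX cardsT cN cards1 muln1.
have h2 : (#|quadric| <= #|F| * #|F|.-1)%N.
  by apply: leq_trans (leq_imset_card _ _) _; rewrite cardsX cardsT cN.
have h3 : (#|parallel_points| <= #|F|.-1 * #|F|.-1)%N.
  by apply: leq_trans (leq_imset_card _ _) _; rewrite cardsX cN.
have [+ _] := leq_card_setU (holed_plane :|: quadric) parallel_points.
have [+ _] := leq_card_setU holed_plane quadric.
rewrite -/blocking_set; case: #|F| F1 h1 h2 h3 => // n _ /= h1 h2 h3 h4 h5.
nia.
Qed.

Lemma holed_plane_blocking (x y : F) :
  (y != 0) || (x \in D) -> point3 x y 0 \in blocking_set.
Proof.
move=> h; rewrite !inE; do 2![apply/orP; left].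
apply/imsetP; exists (x, y) => //.
by rewrite !inE /= andbC; case: (y == 0) h.
Qed.

Lemma quadric_blocking (x y z : F) : z != 0 -> y = x * z -> point3 x y z \in blocking_set.
Proof.
move=> z0 ->; rewrite !inE; apply/orP; left; apply/orP; right.
by apply/imsetP; exists (x, z); rewrite // !inE.
Qed.

Lemma parallel_point_blocking (d z : F) :
  d != 0 -> z != 0 -> parallel_point d z \in blocking_set.
Proof.
move=> d0 z0; rewrite !inE; apply/orP; right.
by apply/imsetP; exists (d, z); rewrite // !inE d0.
Qed.

Hypothesis D0 : 0 \in D.
Hypothesis wD : forall d, w d \in D.
Hypothesis wBD : forall d, w d - d \in D.

Lemma horizontal_line_blocked (x y z u v : F) :
  (u != 0) || (v != 0) ->
  exists t, point3 x y z + t *: point3 u v 0 \in blocking_set.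
Proof.
move=> uv; have [->|z0] := eqVneq z 0.
  have [v0|v0] := eqVneq v 0.
    rewrite v0 eqxx orbF in uv; exists (- x / u).
    rewrite point3_line mulr0 addr0 divfK // addrN.
    by apply: holed_plane_blocking; rewrite D0 orbT.
  exists ((1 - y) / v); rewrite point3_line mulr0 addr0 divfK //.
  by apply: holed_plane_blocking; rewrite addrC subrK oner_eq0.
(* At a fixed height z <> 0 the quadric is the line y = x z, which every non-parallel line
   crosses. *)
have [vE|vE] := eqVneq v (u * z); last first.
  have k0 : v - u * z != 0 by rewrite subr_eq0.
  exists ((x * z - y) / (v - u * z)); rewrite point3_line mulr0 addr0.
  by apply: quadric_blocking => //; field.
have u0 : u != 0.
  by apply: contraTneq uv => u0; rewrite vE u0 mul0r eqxx.
have [k0|k0] := eqVneq y (x * z).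
  exists 0; rewrite point3_line !mul0r !addr0.
  exact: quadric_blocking.
pose d := (y - x * z) / z.
have d0 : d != 0 by rewrite mulf_neq0 ?invr_eq0 // subr_eq0.
have := parallel_point_blocking _ _ d0 z0.
rewrite /parallel_point; case: ifP => _ inB.
  exists ((- d - x) / u); move: inB; rewrite point3_line vE mulr0 addr0 /d.
  by apply: eq_point3; field; rewrite u0 z0.
exists ((z^-1 - d - x) / u); move: inB; rewrite point3_line vE mulr0 addr0 /d.
by apply: eq_point3; field; rewrite u0 z0.
Qed.

Lemma line_through_hole_blocked (c s t : F) :
  c \notin D ->
  exists2 z, z != 0 & point3 (c + s * z) (t * z) z \in blocking_set.
Proof.
move=> cD; have c0 : c != 0 by apply: contraNneq cD => ->.
have [s0|s0] := eqVneq s 0.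
  have [tc|tc] := eqVneq t c.
    exists 1; first exact: oner_neq0.
    by apply: quadric_blocking; rewrite ?oner_neq0 // s0 tc mul0r addr0.
  have d0 : t - c != 0 by rewrite subr_eq0.
  (* With d = t - c, the value w(d) = t would put w(d) - d = c in [D]. *)
  have wt : w (t - c) != t.
    by apply: contraNneq cD => wt; have := wBD (t - c); rewrite wt subKr.
  have [t0|t0] := eqVneq t 0.
    (* The line stays in y = 0, so the exceptional point (-d, 0, z) = (c, 0, z) at z = 1/w(d) is
       used. *)
    have w0 : w (t - c) != 0 by rewrite -t0.
    have z0 : (w (t - c))^-1 != 0 by rewrite invr_eq0.
    exists (w (t - c))^-1 => //; have := parallel_point_blocking _ _ d0 z0.
    by rewrite /parallel_point invrK eqxx s0 t0 !mul0r addr0 sub0r opprK.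
  (* At z = 1/t the line has y = 1 and x = c = 1/z - d. *)
  have z0 : t^-1 != 0 by rewrite invr_eq0.
  exists t^-1 => //; have := parallel_point_blocking _ _ d0 z0.
  by rewrite /parallel_point invrK (negPf wt) s0 mul0r addr0 divff // subKr.
have [tc|tc] := eqVneq t c; last first.
  have tc0 : t - c != 0 by rewrite subr_eq0.
  have z0 : (t - c) / s != 0 by rewrite mulf_neq0 // invr_eq0.
  by exists ((t - c) / s) => //; apply: quadric_blocking => //; field.
(* Here d = - s z varies along the line; z = 1/c is the height at which y = 1. *)
have z0 : c^-1 != 0 by rewrite invr_eq0.
have d0 : - (s / c) != 0 by rewrite oppr_eq0 mulf_neq0.
have wc : w (- (s / c)) != c by apply: contraNneq cD => <-.
exists c^-1 => //; have := parallel_point_blocking _ _ d0 z0.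
by rewrite /parallel_point invrK (negPf wc) tc divff // opprK.
Qed.

Lemma line_blocked (a b : 'rV[F]_3) :
  b != 0 -> exists t, a + t *: b \in blocking_set.
Proof.
rewrite (point3E a) (point3E b).
(* The line runs through (x, y, z) with direction (u, v, k). *)
move: (a _ _) (a _ _) (a _ _) (b _ _) (b _ _) (b _ _) => z y x k v u.
have [->|k0] := eqVneq k 0 => b0.
  apply: horizontal_line_blocked; apply: contraNT b0.
  by rewrite negb_or !negbK => /andP[/eqP-> /eqP->]; rewrite point3_eq0.
(* The line crosses the plane z = 0 at (c, e, 0). *)
pose c := x - z / k * u; pose e := y - z / k * v.
have [h|] := boolP ((e != 0) || (c \in D)).
  exists (- (z / k)); rewrite point3_line !mulNr divfK // addrN.
  exact: holed_plane_blocking.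
rewrite negb_or negbK => /andP[/eqP e0 cD].
have [h _ inB] := line_through_hole_blocked c (u / k) (v / k) cD.
exists ((h - z) / k); move: inB; rewrite point3_line.
have -> : y + (h - z) / k * v = e + v / k * h by rewrite /e; field.
rewrite e0 add0r divfK // subrKC.
by apply: eq_point3 => //; rewrite /c; field.
Qed.

End BlockingSet.

(** * A difference basis of F_p with at most 2 sqrt p elements *)

Lemma nat_sqrt_floor n : exists a, (a ^ 2 <= n < a.+1 ^ 2)%N.
Proof.
elim: n => [|n [a /andP[h1 h2]]]; first by exists 0%N.
have [h|h] := ltnP n.+1 (a.+1 ^ 2); first by exists a; rewrite h andbT ltnW.
by exists a.+1; rewrite h /=; nia.
Qed.

Lemma Fp_natP {p : nat} (p_prime : prime p) (x : 'F_p) :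
  exists2 n, (n < p)%N & x = n%:R.
Proof.
exists (x : nat); last by rewrite natr_Zp.
by have := ltn_ord x; rewrite [X in (_ < X)%N -> _]Fp_cast.
Qed.

Section DifferenceBasis.
Variables (p a : nat).
Hypothesis p_prime : prime p.
Hypothesis ap : (a ^ 2 <= p < a.+1 ^ 2)%N.

(** The baby-step giant-step pattern, with [a] the integer part of sqrt p. *)
Definition difference_basis : {set 'F_p} :=
  [set (i : nat)%:R | i : 'I_a] :|: [set (i.+1 * a)%:R | i : 'I_a].

Lemma card_difference_basis : (#|difference_basis| <= 2 * a)%N.
Proof.
rewrite mul2n -addnn; apply: leq_trans (leq_card_setU _ _) _.
by apply: leq_add; apply: leq_trans (leq_imset_card _ _) _; rewrite card_ord.
Qed.

Lemma sqrt_floor_gt0 : (0 < a)%N.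
Proof. by have := prime_gt1 p_prime; case: a ap => //; lia. Qed.

Lemma difference_basis0 : 0 \in difference_basis.
Proof. by rewrite inE; apply/orP; left; apply/imsetP; exists (Ordinal sqrt_floor_gt0). Qed.

(** Division gives n - 1 = q a + r with r < a, hence n = (q + 1) a - (a - 1 - r). Dividing n - 1
    rather than n keeps q below [a] when n = a^2. *)
Lemma difference_basis_small n : (0 < n <= a ^ 2)%N ->
  exists2 w, w \in difference_basis & w - n%:R \in difference_basis.
Proof.
move=> /andP[n0 na]; have a0 := sqrt_floor_gt0.
have kP : (n.-1 %/ a < a)%N by rewrite ltn_divLR //; nia.
have rP : (a.-1 - n.-1 %% a < a)%N by lia.
have nE := divn_eq n.-1 a; have rlt := ltn_pmod n.-1 a0.
exists ((n.-1 %/ a).+1 * a)%:R.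
  by rewrite inE; apply/orP; right; apply/imsetP; exists (Ordinal kP).
rewrite inE; apply/orP; left; apply/imsetP; exists (Ordinal rP) => //=.
apply/eqP; rewrite subr_eq -natrD; apply/eqP; congr (_%:R); nia.
Qed.

(* The differences reach every n <= a^2 only; since p <= 2 a^2 + 1, negation
   gives the remaining residues. *)
Lemma difference_basisP (d : 'F_p) :
  exists2 w, w \in difference_basis & w - d \in difference_basis.
Proof.
have [n np ->] := Fp_natP p_prime d.
have [->|n0] := posnP n; first by exists 0; rewrite ?subrr difference_basis0.
have [na|an] := leqP n (a ^ 2); first by apply: difference_basis_small; rewrite n0.
have [|w wD wBD] := @difference_basis_small (p - n)%N; first by nia.
exists (w - (p - n)%:R) => //.
by rewrite natrB ?(ltnW np) // pchar_Fp_0 // sub0r opprK addrK.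
Qed.

End DifferenceBasis.

(** * From blocking sets to progression-free sets *)

Lemma mem_progression_full {p n : nat} (p_prime : prime p)
    (a b : 'rV['F_p]_n) (t : 'F_p) : a + t *: b \in progression p a b.
Proof.
have [k kp ->] := Fp_natP p_prime t.
by apply/imsetP; exists (Ordinal kp); rewrite //= scaler_nat.
Qed.

Lemma progression_free_setC {p n : nat} (p_prime : prime p)
    (B : {set 'rV['F_p]_n}) :
  (forall a b, b != 0 -> exists t, a + t *: b \in B) ->
  progression_free p (~: B).
Proof.
move=> Bline; apply/forallP=> P; apply/implyP=> /existsP[a /existsP[b]].
move=> /andP[b0 /eqP->]; have [t tB] := Bline a b b0.
apply/negP=> /subsetP/(_ _ (mem_progression_full p_prime a b t)).
by rewrite inE tB.
Qed.

Lemma r_3_ge {p a : nat} : prime p -> (a ^ 2 <= p < a.+1 ^ 2)%N ->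
  (p ^ 3 + 4 * p <= r_ p p 3 + 3 * p ^ 2 + 1 + 2 * a)%N.
Proof.
move=> p_prime ap; pose D := difference_basis p a.
have /fin_all_exists2[w wD wBD] := difference_basisP p a p_prime ap.
pose B := blocking_set _ D w.
have D0 : 0 \in D := difference_basis0 p a p_prime ap.
have cF : #|'F_p| = p := card_Fp p_prime.
have free : progression_free p (~: B).
  by apply: progression_free_setC => // x y; apply: line_blocked.
have le_r : (#|~: B| <= r_ p p 3)%N by apply: leq_bigmax_cond.
have cB : (#|B| + 4 * p <= 3 * p ^ 2 + 1 + 2 * a)%N.
  have := card_blocking_set _ D w; rewrite cF => /leq_trans; apply.
  by rewrite leq_add2l card_difference_basis.
by have := cardsC B; rewrite card_mx cF mul1n; lia.
Qed.

Theorem theorem1p1 (R : rcfType) (p : nat) (p_prime : prime p) (p_ge5 : (5 <= p)%N) :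
  (r_ p p 3)%:R >= (p%:R - 1) ^+ 3 + p%:R - 2 * Num.sqrt p%:R :> R /\
  (p%:R - 1) ^+ 3 + p%:R - 2 * Num.sqrt p%:R
    = p%:R ^+ 3 - 3 * p%:R ^+ 2 + 4 * p%:R - 2 * Num.sqrt p%:R - 1 :> R.
Proof.
split; last by ring.
have [a ap] := nat_sqrt_floor p; have := r_3_ge p_prime ap.
rewrite -(ler_nat R) !natrD !natrX => le_r.
(* This turns the integer loss 2a into the real loss 2 sqrt p. *)
have a_le : a%:R <= Num.sqrt p%:R :> R.
  rewrite -[a%:R]ger0_norm // -sqrtr_sqr ler_sqrt // -natrX ler_nat.
  by case/andP: ap.
nra.
Qed.
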